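(* Let $G$ be a left ordered group, $H$ a torsion free nilpotent group, and $C$ a cyclic group equipped with injective homomorphisms into $G$ and into $H$. Then the free product with amalgamation $G*_CH$ is left orderable.
   Context: A left ordered group is a group with a total order $\le$ such that $x\le y\Rightarrow gx\le gy$ for all group elements $g,x,y$. *)

(* Defs.v *)
From HB Require Import structures.
From mathcomp Require Import all_boot.
Set Implicit Arguments. Unset Strict Implicit. Unset Printing Implicit Defensive.

Local Open Scope group_scope.

Definition is_hom (G H : groupType) (f : G -> H) : Prop :=
  forall x y : G, f (x * y) = f x * f y.

Definition left_order (G : groupType) (le : G -> G -> Prop) : Prop :=
  [/\ (forall x, le x x),
      (forall x y, le x y -> le y x -> x = y),
      (forall x y z, le x y -> le y z -> le x z),
      (forall x y, le x y \/ le y x) &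
      (forall g x y, le x y -> le (g * x) (g * y))].

Definition left_orderable (G : groupType) : Prop :=
  exists le : G -> G -> Prop, left_order le.

Definition torsion_free (G : groupType) : Prop :=
  forall (x : G) (n : nat), (0 < n)%N -> x ^+ n = 1 -> x = 1.

Definition is_subgroup (G : groupType) (K : G -> Prop) : Prop :=
  K 1 /\ (forall x y, K x -> K y -> K (x * y^-1)).

Definition gen (G : groupType) (S : G -> Prop) : G -> Prop :=
  fun g => forall K : G -> Prop, is_subgroup K -> (forall x, S x -> K x) -> K g.

Fixpoint lcs (G : groupType) (n : nat) : G -> Prop :=
  match n with
  | 0 => fun _ => True
  | m.+1 => gen (fun g => exists x y : G, @lcs G m x /\ g = x^-1 * (y^-1 * x * y))
  end.

Definition nilpotent (G : groupType) : Prop :=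
  exists n : nat, forall g : G, @lcs G n g -> g = 1.

Definition cyclic_group (C : groupType) : Prop :=
  exists c : C, forall x : C, exists n : nat, x = c ^+ n \/ x = (c ^+ n)^-1.

(* P together with iG, iH is the free product of G and H amalgamated along
   C (via a : C -> G, b : C -> H), characterized by its universal property
   (the pushout in the category of groups). *)
Definition is_amalgamated_product (C G H P : groupType)
  (a : C -> G) (b : C -> H) (iG : G -> P) (iH : H -> P) : Prop :=
  [/\ is_hom iG, is_hom iH, (forall c, iG (a c) = iH (b c)) &
   forall (K : groupType) (f : G -> K) (g : H -> K),
     is_hom f -> is_hom g -> (forall c, f (a c) = g (b c)) ->
     (exists h : P -> K, [/\ is_hom h, (forall x, h (iG x) = f x) &
                                        (forall y, h (iH y) = g y)]) /\
     (forall h1 h2 : P -> K,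
        is_hom h1 -> (forall x, h1 (iG x) = f x) -> (forall y, h1 (iH y) = g y) ->
        is_hom h2 -> (forall x, h2 (iG x) = f x) -> (forall y, h2 (iH y) = g y) ->
        forall p, h1 p = h2 p)].

(* Main.v *)
Require Import Defs.
From HB Require Import structures.
From mathcomp Require Import all_boot.
From mathcomp Require Import boolp wochoice classical_sets.

(** Both factors are left orderable: for [H] this comes from the upper central
    series, whose terms are isolated, so that each central section acquires a
    positive cone. Left orderability of the amalgam then uses only that [C] is
    cyclic.

    A totally ordered set with a free [C]-action embeds [C]-equivariantly in one
    with a free [G]-action, and the embedding can be chosen to extend a [G]-action
    already given on a [C]-invariant subset [X]: new points are first compared by
    the cuts they induce on [X], and then by how the [C]-orbit of each point [q]
    is cut, transported to [G] along [c |-> a c] (in the order of [G] or its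
    reverse, according to whether [C] moves [q] in the positive or the negative
    direction). Alternating such extensions between [G] and [H] gives in the
    limit a totally ordered set on which [G] and [H] act compatibly, hence on
    which the amalgam [P] acts. Every point carries a label in [P], equivariantly,
    so that stabilizers in [P] are trivial and the order of one orbit is a left
    order on [P]. *)

Set Implicit Arguments. Unset Strict Implicit. Unset Printing Implicit Defensive.

Local Open Scope group_scope.

(** * Preorders, actions and lexicographic comparison *)

Definition total_preorder (T : Type) (R : T -> T -> Prop) : Prop :=
  (forall x y, R x y \/ R y x) /\ (forall x y z, R x y -> R y z -> R x z).

Definition eqv (T : Type) (R : T -> T -> Prop) (x y : T) : Prop := R x y /\ R y x.

(* The laws of an action hold only up to the equivalence of the preorder; this
   is what lets every stage below be a plain product type, with no quotient. *)
Record free_action (G : groupType) (T : Type) (R : T -> T -> Prop)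
    (act : G -> T -> T) : Prop := FreeAction {
  act_mono : forall g x y, R x y -> R (act g x) (act g y);
  act_one : forall x, eqv R (act 1 x) x;
  act_mul : forall g h x, eqv R (act (g * h) x) (act g (act h x));
  act_free : forall g x, eqv R (act g x) x -> g = 1 }.

Section Eqv.
Variables (T : Type) (R : T -> T -> Prop).
Hypothesis Rtot : total_preorder R.

Lemma tp_refl x : R x x.
Proof. by case: (Rtot.1 x x). Qed.

Lemma tp_trans x y z : R x y -> R y z -> R x z.
Proof. exact: Rtot.2. Qed.

Lemma eqv_refl x : eqv R x x.
Proof. by split; apply: tp_refl. Qed.

Lemma eqv_sym x y : eqv R x y -> eqv R y x.
Proof. by case. Qed.

Lemma eqv_trans x y z : eqv R x y -> eqv R y z -> eqv R x z.
Proof. by move=> [xy yx] [yz zy]; split; [apply: tp_trans xy yz | apply: tp_trans zy yx]. Qed.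

Lemma eqvl x y z : eqv R x y -> R x z <-> R y z.
Proof. by case=> xy yx; split=> h; [apply: tp_trans yx h | apply: tp_trans xy h]. Qed.

Lemma eqvr x y z : eqv R x y -> R z x <-> R z y.
Proof. by case=> xy yx; split=> h; apply: tp_trans h _. Qed.

Section Action.
Variables (G : groupType) (act : G -> T -> T).
Hypothesis Ract : free_action R act.

Lemma act_eqv g x y : eqv R x y -> eqv R (act g x) (act g y).
Proof. by case=> xy yx; split; apply: (act_mono Ract). Qed.

Lemma actK g x : eqv R (act g^-1 (act g x)) x.
Proof.
apply: eqv_trans (act_one Ract x); rewrite -(mulVg g).
exact/eqv_sym/(act_mul Ract).
Qed.

Lemma act_le g x y : R (act g x) (act g y) <-> R x y.
Proof.
split=> [/(act_mono Ract g^-1)|]; last exact: (act_mono Ract).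
by move=> /(eqvl _ (actK g x))/(eqvr _ (actK g y)).
Qed.

Lemma act_V g x y : R (act g^-1 x) y <-> R x (act g y).
Proof.
by rewrite -(act_le g^-1 x) (eqvr _ (actK g y)).
Qed.

Lemma act_Vr g x y : R x (act g^-1 y) <-> R (act g x) y.
Proof. by rewrite -(act_le g^-1 (act g x)) (eqvl _ (actK g x)). Qed.

Lemma act_exp_le g x n : R (act g x) x -> R (act (g ^+ n.+1) x) (act g x).
Proof.
move=> gx; elim: n => [|n IHn]; first by rewrite expg1; apply: tp_refl.
rewrite expgS; apply/(eqvl _ (act_mul Ract _ _ _)).
by apply: (act_mono Ract); apply: tp_trans gx.
Qed.

End Action.
End Eqv.

(** * Lexicographic comparison of nested sets along a well-ordered index *)

Section Lex.
Variables (I Z V : Type) (lt : I -> I -> Prop) (F : I -> Z -> V -> Prop).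
Hypothesis lt_wf : well_founded lt.
Hypothesis lt_tri : forall i j, [\/ lt i j, i = j | lt j i].
Hypothesis Fchain : forall i z z',
  (forall v, F i z v -> F i z' v) \/ (forall v, F i z' v -> F i z v).

(** Well-foundedness rules out cycles of length two and three, so trichotomy leaves only
    [lt i k]. *)
Lemma lt_trans i j k : lt i j -> lt j k -> lt i k.
Proof.
have asym : forall x y, lt x y -> lt y x -> False.
  by elim/(well_founded_ind lt_wf) => x IHx y xy yx; exact: (IHx y yx x yx xy).
have acyclic : forall x y z, lt x y -> lt y z -> lt z x -> False.
  by elim/(well_founded_ind lt_wf) => x IHx y z xy yz zx; exact: (IHx z zx x y zx xy yz).
move=> ij jk; have [//|ik|ki] := lt_tri i k; last by case: (acyclic _ _ _ ij jk ki).
by case: (asym _ _ ij); rewrite ik.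
Qed.

(** Inclusion of sections at the first index where they differ, phrased without naming that
    index. *)
Definition lex (z z' : Z) : Prop :=
  forall i, (forall j, lt j i -> forall v, F j z v <-> F j z' v) ->
    forall v, F i z v -> F i z' v.

Lemma lex_total z z' : lex z z' \/ lex z' z.
Proof.
have [|/existsNP[i /not_implyP[eq_lt nle]]] := EM (lex z z'); first by left.
right=> k eq_ltk; have [ki|->|ik] := lt_tri k i.
- by move=> v /eq_lt; apply.
- by case: (Fchain i z z').
- by case: nle => v /eq_ltk; apply.
Qed.

Lemma lex_trans z1 z2 z3 : lex z1 z2 -> lex z2 z3 -> lex z1 z3.
Proof.
move=> le12 le23 i eq13.
(* Below [i], each section of [z2] is squeezed between those of [z1] and [z3], which coincide
   there. *)
have eq_lt j : lt j i -> (forall v, F j z1 v <-> F j z2 v) /\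
                         (forall v, F j z2 v <-> F j z3 v).
  elim/(well_founded_ind lt_wf): j => j IHj ji.
  have IH k (kj : lt k j) := IHj k kj (lt_trans kj ji).
  have h12 := le12 j (fun k kj => (IH k kj).1).
  have h23 := le23 j (fun k kj => (IH k kj).2).
  by split=> v; split=> h; auto; [apply/(eq13 _ ji)/h23 | apply/h12/(eq13 _ ji)].
by move=> v /(le12 i (fun k ki => (eq_lt k ki).1))/(le23 i (fun k ki => (eq_lt k ki).2)).
Qed.

Lemma lex_eq z z' : lex z z' -> lex z' z -> forall i v, F i z v <-> F i z' v.
Proof.
move=> le1 le2; elim/(well_founded_ind lt_wf) => i IHi v.
by split; [apply: le1 | apply: le2] => // j ji w; split=> /(IHi _ ji).
Qed.

End Lex.

(** The strict relation is the failure of [R y x]; an [R]-least inaccessible point would be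
    accessible. *)
Lemma well_order_exists (T : Type) : exists lt : T -> T -> Prop,
  well_founded lt /\ forall i j, [\/ lt i j, i = j | lt j i].
Proof.
elim/Peq: T => T; have [R Rwo] := well_ordering_principle T.
exists (fun x y => ~~ R y x); split.
  move=> x; apply: contrapT => nacc.
  pose A := [pred y | `[< ~ Acc (fun x y => ~~ R y x) y >]].
  have [|m [[/asboolP mA mlow] _]] := Rwo A; first by exists x; apply/asboolP.
  apply: mA; constructor => y /negP nRmy; apply: contrapT => nA.
  by apply/nRmy/mlow/asboolP.
have Rch : wo_chain R predT by move=> A _; exact: Rwo.
move=> i j; have [ij|] := boolP (R i j); last by constructor 3.
have [ji|] := boolP (R j i); last by constructor 1.
by constructor 2; apply: (wo_chain_antisymmetric Rch) => //; rewrite ij ji.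
Qed.

(** * Extending a free action of a cyclic subgroup *)

Lemma is_hom1 (G K : groupType) (f : G -> K) : is_hom f -> f 1 = 1.
Proof. by move=> fM; apply: (mulgI (f 1)); rewrite -fM !mulg1. Qed.

Lemma is_homV (G K : groupType) (f : G -> K) x : is_hom f -> f x^-1 = (f x)^-1.
Proof. by move=> fM; apply: (mulgI (f x)); rewrite -fM !mulgV (is_hom1 fM). Qed.

Lemma is_homX (G K : groupType) (f : G -> K) x n : is_hom f -> f (x ^+ n) = f x ^+ n.
Proof.
move=> fM; elim: n => [|n IHn]; first by rewrite !expg0 (is_hom1 fM).
by rewrite !expgS fM IHn.
Qed.

Section LeftOrder.
Variables (G : groupType) (le : G -> G -> Prop).
Hypothesis leo : left_order le.

Lemma lo_preorder : total_preorder le.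
Proof. by case: leo => _ _ tr tot _; split. Qed.

Lemma lo_anti x y : eqv le x y -> x = y.
Proof. by case: leo => _ anti _ _ _ [xy yx]; apply: anti. Qed.

Lemma lo_mul g x y : le (g * x) (g * y) <-> le x y.
Proof.
case: leo => _ _ _ _ mono; split; last exact: mono.
by move/(mono g^-1); rewrite !mulKg.
Qed.

Lemma lo_exp_ge x n : le 1 x -> le 1 (x ^+ n).
Proof.
move=> x1; elim: n => [|n IHn]; first exact: (tp_refl lo_preorder).
by apply: (tp_trans lo_preorder x1); rewrite expgS -{1}[x]mulg1 lo_mul.
Qed.

Lemma lo_V x : le 1 x^-1 <-> le x 1.
Proof. by rewrite -(lo_mul x) mulg1 mulgV. Qed.

Lemma lo_Vr x : le x^-1 1 <-> le 1 x.
Proof. by rewrite -lo_V invgK. Qed.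

Lemma lo_exp_le x n : le x 1 -> le (x ^+ n) 1.
Proof. by rewrite -!lo_V -expVgn; apply: lo_exp_ge. Qed.

(* This is the only use made of cyclicity. *)
Lemma cyclic_opposite (C : groupType) (a : C -> G) c d :
  cyclic_group C -> is_hom a -> injective a ->
  le (a c) 1 -> ~ le (a d) 1 -> c <> 1 ->
  exists i j, c ^+ i.+1 * d ^+ j.+1 = 1.
Proof.
move=> [z Cz] aM aI.
(* The sign of [a z] forces [c] and [d] to be powers of [z] of opposite signs; raising each to the
   absolute exponent of the other makes them cancel. *)
have [z1|z1] := (lo_preorder).1 (a z) 1.
  have zn n : le (a (z ^+ n)) 1 by rewrite (is_homX _ _ aM); apply: lo_exp_le.
  case: (Cz d) => [n [->|->]]; first by have := zn n.
  case: (Cz c) => [m [->|->]].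
    case: m => [|m]; first by rewrite expg0.
    case: n => [|n]; first by rewrite expg0 invg1 (is_hom1 aM) => _ /(_ (tp_refl lo_preorder 1)).
    move=> _ _ _; exists n, m; rewrite expVgn -!expgnA mulnC mulgV //.
  rewrite (is_homV _ aM) => le1 _ []; apply: aI; rewrite (is_homV _ aM) (is_hom1 aM).
  by apply: lo_anti; split=> //; apply/lo_V.
have zn n : le 1 (a (z ^+ n)) by rewrite (is_homX _ _ aM); apply: lo_exp_ge.
case: (Cz d) => [n [->|->]]; last by move=> _ []; rewrite (is_homV _ aM) lo_Vr.
case: (Cz c) => [m [->|->]].
  move=> le1 _ []; apply: aI; rewrite (is_hom1 aM).
  by apply: lo_anti; split.
case: m => [|m]; first by rewrite expg0 invg1.
case: n => [|n]; first by rewrite expg0 (is_hom1 aM) => _ /(_ (tp_refl lo_preorder 1)).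
by move=> _ _ _; exists n, m; rewrite expVgn -!expgnA mulnC mulVg.
Qed.

End LeftOrder.

(** * The order on formal [G]-translates of the points of a [C]-set *)

Section Induction.
Variables (G C : groupType) (le : G -> G -> Prop) (a : C -> G).
Hypotheses (leo : left_order le) (Ccyc : cyclic_group C).
Hypotheses (aM : is_hom a) (aI : injective a).
Variables (X Y : Type) (R : Y -> Y -> Prop) (iota : X -> Y).
Variables (actC : C -> Y -> Y) (actG : G -> X -> X).
Hypothesis Rtot : total_preorder R.
Hypothesis actCP : free_action R actC.
Hypothesis actGP : free_action (fun x x' => R (iota x) (iota x')) actG.
Hypothesis iota_act : forall c x, eqv R (iota (actG (a c) x)) (actC c (iota x)).

Let Xle x x' := R (iota x) (iota x').

Let Xtot : total_preorder Xle.
Proof. by split=> [x y|x y z]; [apply: Rtot.1 | apply: Rtot.2]. Qed.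

Let actGP' : free_action Xle actG := actGP.

(** A pair [(g, y)] stands for the translate of [y] by [g]. As [G] acts only on [X], the comparison
    with [x] is made after moving [g^-1] onto [x]. *)
Definition below (z : G * Y) (x : X) : Prop := R (iota (actG z.1^-1 x)) z.2.
Definition above (z : G * Y) (x : X) : Prop := R z.2 (iota (actG z.1^-1 x)).

(** Both halves matter: a pair at a point of [X] and a pair just above that point can have the same
    lower half. *)
Definition cut_le (z z' : G * Y) : Prop :=
  (forall x, below z x -> below z' x) /\ (forall x, above z' x -> above z x).

Lemma cut_le_total z z' : cut_le z z' \/ cut_le z' z.
Proof.
have below_le u x y : Xle x y -> below u y -> below u x.
  by move=> /(act_mono actGP' u.1^-1); apply: (tp_trans Rtot).
have above_le u x y : Xle x y -> above u x -> above u y.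
  by move=> /(act_mono actGP' u.1^-1) xy ux; apply: (tp_trans Rtot) xy.
have above_or_below u x : above u x \/ below u x by apply: Rtot.1.
have sep_below u v x : below u x -> ~ below v x -> cut_le v u.
  move=> ux vx; split=> y vy.
    have [yx|/below_le/(_ vy)//] := Xtot.1 y x; exact: below_le yx ux.
  have [|//] := above_or_below v x; apply: above_le.
  by rewrite -(act_le Xtot actGP' u.1^-1); apply: (tp_trans Rtot) ux vy.
have sep_above u v x : above u x -> ~ above v x -> cut_le u v.
  move=> ux vx; split=> y uy.
    have [//|] := above_or_below v x; apply: below_le.
    by rewrite -(act_le Xtot actGP' u.1^-1); apply: (tp_trans Rtot) uy ux.
  have [xy|/above_le/(_ uy)//] := Xtot.1 x y; exact: above_le xy ux.
have [|/not_andP[]/existsNP[x /not_implyP[]]] := EM (cut_le z z'); first by left.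
  by move=> zx z'x; right; apply: sep_below zx z'x.
by move=> z'x zx; right; apply: sep_above z'x zx.
Qed.

Lemma cut_le_trans z1 z2 z3 : cut_le z1 z2 -> cut_le z2 z3 -> cut_le z1 z3.
Proof. by move=> [b12 a12] [b23 a23]; split=> x h; [apply/b23/b12 | apply/a12/a23]. Qed.

Definition translate (g : G) (z : G * Y) : G * Y := (g * z.1, z.2).

Lemma below_translate g z x : below (translate g z) x <-> below z (actG g^-1 x).
Proof. by rewrite /below /= invgM; apply: (eqvl Rtot); exact: (act_mul actGP'). Qed.

Lemma above_translate g z x : above (translate g z) x <-> above z (actG g^-1 x).
Proof. by rewrite /above /= invgM; apply: (eqvr Rtot); exact: (act_mul actGP'). Qed.

Lemma cut_le_translate g z z' : cut_le z z' -> cut_le (translate g z) (translate g z').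
Proof.
move=> [bl ab]; split=> x; first by rewrite !below_translate; apply: bl.
by rewrite !above_translate; apply: ab.
Qed.

Definition fwd (q : Y) : Prop := forall c, R (actC c q) q -> le (a c) 1.
Definition leq_at (q : Y) (k k' : G) : Prop :=
  (fwd q -> le k k') /\ (~ fwd q -> le k' k).

(** For [z = (g, y)], the part of the orbit of [q] below [y] is carried into [G] by [c |-> g * a c].
    Closing it downwards for [leq_at q] makes these sets nested as [z] varies. *)
Definition orbit_cut (q : Y) (z : G * Y) (k : G) : Prop :=
  exists2 c, R (actC c q) z.2 & leq_at q k (z.1 * a c).

Lemma leq_at_trans q k1 k2 k3 : leq_at q k1 k2 -> leq_at q k2 k3 -> leq_at q k1 k3.
Proof.
move=> [f12 b12] [f23 b23]; split=> h; apply: (tp_trans (lo_preorder leo)); eauto.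
Qed.

Lemma leq_at_refl q k : leq_at q k k.
Proof. by split=> _; apply: (tp_refl (lo_preorder leo)). Qed.

Lemma leq_at_mul q g k k' : leq_at q (g * k) (g * k') <-> leq_at q k k'.
Proof. by rewrite /leq_at !(lo_mul leo). Qed.

Lemma leq_at_anti q k k' : leq_at q k k' -> leq_at q k' k -> k = k'.
Proof.
by move=> [f12 b12] [f21 b21]; apply: (lo_anti leo); case: (EM (fwd q)) => h; split; auto.
Qed.

(* Why the direction of [leq_at] is chosen by [fwd]: the part of the orbit of
   [q] below [q] is then below [1] in [G]. *)
Lemma orbit_max q c : R (actC c q) q -> leq_at q (a c) 1.
Proof.
move=> cq; split=> [/(_ c cq)//|/existsNP[d /not_implyP[dq d1]]].
apply: contrapT => c1; have cle : le (a c) 1 by case: ((lo_preorder leo).1 (a c) 1).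
have cN1 : c <> 1 by move=> c_eq; apply: c1; rewrite c_eq (is_hom1 aM); apply: (tp_refl (lo_preorder leo)).
have [i [j cd1]] := cyclic_opposite leo Ccyc aM aI cle d1 cN1.
(* It remains to see that [q] is below [c q]. As [d] moves [q] down, so does [d ^+ j.+1]; hence [q],
   equivalent to its image under [c ^+ i.+1 * d ^+ j.+1], is below [c ^+ i.+1] applied to [q], which
   is below [c q]. *)
apply/cN1/(act_free actCP (x := q)); split=> //.
have /(tp_trans Rtot) := (act_one actCP q).2; rewrite -cd1 => h.
have {h} h := h _ (act_mul actCP _ _ _).1.
apply: (tp_trans Rtot h); apply: (tp_trans Rtot) (act_exp_le Rtot actCP i cq).
apply: (act_mono actCP); apply: (tp_trans Rtot) (dq); exact: (act_exp_le Rtot actCP).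
Qed.

Lemma orbit_cut_chain q z z' :
  (forall k, orbit_cut q z k -> orbit_cut q z' k) \/
  (forall k, orbit_cut q z' k -> orbit_cut q z k).
Proof.
have [|/existsNP[k /not_implyP[[c cz kc] nk]]] :=
  EM (forall k, orbit_cut q z k -> orbit_cut q z' k); first by left.
right=> l [d dz' ld]; exists c => //; apply: leq_at_trans ld _.
have leq_tot u v : leq_at q u v \/ leq_at q v u.
  have [uv|vu] := (lo_preorder leo).1 u v; case: (EM (fwd q)) => h.
  - by left. - by right. - by right. - by left.
have [//|cd] := leq_tot (z'.1 * a d) (z.1 * a c).
by case: nk; exists d => //; apply: leq_at_trans cd.
Qed.

Lemma orbit_cut_translate q g z k : orbit_cut q (translate g z) k <-> orbit_cut q z (g^-1 * k).
Proof.
have shift c : leq_at q (g^-1 * k) (z.1 * a c) <-> leq_at q k (g * z.1 * a c).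
  by rewrite -(leq_at_mul q g) !mulgA mulgV mul1g.
by split=> -[c cz h]; exists c => //; apply/shift.
Qed.

Lemma orbit_cut_mono q g y y' : R y y' -> forall k, orbit_cut q (g, y) k -> orbit_cut q (g, y') k.
Proof. by move=> yy' k [c cy kc]; exists c => //; apply: (tp_trans Rtot) yy'. Qed.

Variable lt : Y -> Y -> Prop.
Hypothesis lt_wf : well_founded lt.
Hypothesis lt_tri : forall i j, [\/ lt i j, i = j | lt j i].

Definition in_base (z : G * Y) : Prop := exists x, below z x /\ above z x.

(** Pairs with the same cut are identified when a point of [X] realizes it, because there the action
    of [G] is already prescribed; only the other ties go to the orbit cuts. *)
Definition ind_le (z z' : G * Y) : Prop :=
  cut_le z z' /\ (cut_le z' z -> in_base z \/ lex lt orbit_cut z z').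

Lemma in_base_eqv z z' : cut_le z z' -> cut_le z' z -> in_base z -> in_base z'.
Proof. by move=> [b _] [_ ab] [x [bx ax]]; exists x; split; auto. Qed.

Lemma ind_le_preorder : total_preorder ind_le.
Proof.
split=> [z z'|z1 z2 z3].
  have [zz'|nzz'] := EM (cut_le z z'); last first.
    by right; split=> [|/nzz'//]; case: (cut_le_total z z').
  have [z'z|nz'z] := EM (cut_le z' z); last by left; split=> // /nz'z.
  have [l|l] := lex_total lt_tri orbit_cut_chain z z'; [left|right]; split=> // _; by right.
move=> [c12 l12] [c23 l23]; split=> [|c31]; first exact: cut_le_trans c23.
have c21 := cut_le_trans c23 c31; have c32 := cut_le_trans c31 c12.
have [b1|l1] := l12 c21; first by left.
have [b2|l2] := l23 c32; first by left; apply: in_base_eqv b2.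
by right; apply: (lex_trans lt_wf lt_tri l1 l2).
Qed.

Lemma translateK g z : translate g^-1 (translate g z) = z.
Proof. by case: z => h y; rewrite /translate /= mulKg. Qed.

Lemma lex_translate g z z' : lex lt orbit_cut z z' ->
  lex lt orbit_cut (translate g z) (translate g z').
Proof.
move=> l q eq_lt k; rewrite !orbit_cut_translate; apply: l => p pq {}k.
by have := eq_lt p pq (g * k); rewrite !orbit_cut_translate !mulgA mulVg mul1g.
Qed.

Lemma ind_le_translate g z z' : ind_le z z' -> ind_le (translate g z) (translate g z').
Proof.
move=> [czz' l]; split; first exact: cut_le_translate.
move=> /(cut_le_translate g^-1); rewrite !translateK => /l [[x [bx ax]]|]; last first.
  by right; apply: lex_translate.
left; exists (actG g x); rewrite below_translate above_translate /below /above.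
have gx : eqv R (iota (actG z.1^-1 (actG g^-1 (actG g x)))) (iota (actG z.1^-1 x)).
  by have := act_eqv actGP' z.1^-1 (actK Xtot actGP' g x).
by rewrite (eqvl Rtot _ gx) (eqvr Rtot _ gx).
Qed.

(* Comparing the two pairs at [q := z.2] and at [q := z'.2] already identifies them. *)
Lemma ind_eqv z z' : eqv ind_le z z' ->
  (exists c, z.1 = z'.1 * a c /\ eqv R (actC c z.2) z'.2) \/
  (exists x x', [/\ eqv R z.2 (iota x), eqv R z'.2 (iota x') &
                    eqv R (iota (actG z.1 x)) (iota (actG z'.1 x'))]).
Proof.
move=> [[c12 l12] [c21 l21]].
have [/[dup] b1 [x [bx ax]]|nb1] := EM (in_base z).
  right; exists (actG z.1^-1 x), (actG z'.1^-1 x); split; first by split.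
    by have [b _] := c12; have [_ ab] := c21; split; [exact: ab | exact: b].
  have VK g : eqv Xle (actG g (actG g^-1 x)) x.
    by have := actK Xtot actGP' g^-1 x; rewrite invgK.
  by have := eqv_trans Xtot (VK z.1) (eqv_sym (VK z'.1)).
have [//|lzz'] := l12 c21.
have [/(in_base_eqv c21 c12)//|lz'z] := l21 c12.
have eqF := lex_eq lt_wf lzz' lz'z; left.
have self u : orbit_cut u.2 u u.1.
  exists 1; last by rewrite (is_hom1 aM) mulg1; apply: leq_at_refl.
  exact: (act_one actCP _).1.
have [c cz zc] := (eqF z.2 z.1).1 (self z).
have [d dz zd] := (eqF z'.2 z'.1).2 (self z').
(* By [orbit_max], [u.1] is the largest element of the section of [u] at [u.2], so equality of the
   sections recovers it. *)
have top u e : R (actC e u.2) u.2 -> leq_at u.2 (u.1 * a e) u.1.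
  by move=> /orbit_max; rewrite -{2}[u.1]mulg1 leq_at_mul.
have eq1 : z.1 = z'.1 * a c.
  apply: (leq_at_anti zc).
  have [e ez ze] : orbit_cut z.2 z (z'.1 * a c).
    by apply/eqF; exists c => //; apply: leq_at_refl.
  exact: leq_at_trans ze (top _ _ ez).
have eq2 : z'.1 = z.1 * a d.
  apply: (leq_at_anti zd).
  have [e ez ze] : orbit_cut z'.2 z' (z.1 * a d).
    by apply/eqF; exists d => //; apply: leq_at_refl.
  exact: leq_at_trans ze (top _ _ ez).
(* With [d] inverse to [c], the inequality [dz] becomes the converse of [cz]. *)
have cd : d = c^-1.
  apply: (mulgI c); rewrite mulgV; apply: aI; apply: (mulgI z'.1).
  by rewrite aM mulgA -eq1 -eq2 (is_hom1 aM) mulg1.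
exists c; split=> //; split=> //.
by move: dz; rewrite cd (act_V Rtot actCP).
Qed.

(** For the order to be reflected: if [R y y'] failed, [R y' y] would make the two pairs equivalent,
    and either case of [ind_eqv] then makes [y] and [y'] equivalent. *)
Lemma ind_unit y y' : ind_le (1, y) (1, y') <-> R y y'.
Proof.
have mono u v : R u v -> ind_le (1, u) (1, v).
  move=> uv; split=> [|_].
    by split=> x h; [apply: (tp_trans Rtot h uv) | apply: (tp_trans Rtot uv h)].
  by right=> q _; apply: orbit_cut_mono.
split; last exact: mono.
move=> le1; have [//|/mono le2] := Rtot.1 y y'.
case: (ind_eqv (conj le1 le2)) => /= [[c [c1 cy]]|[x [x' [yx yx' xx']]]].
  have c_1 : c = 1 by apply: aI; rewrite (is_hom1 aM) [RHS]c1 mul1g.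
  by rewrite c_1 in cy; apply: (tp_trans Rtot) (act_one actCP y).2 cy.1.
have one u : eqv R (iota (actG 1 u)) (iota u) := act_one actGP u.
apply: (tp_trans Rtot yx.1); apply: (tp_trans Rtot) yx'.2.
by apply: (tp_trans Rtot (one x).2); apply: (tp_trans Rtot xx'.1 (one x').1).
Qed.

(** The cuts agree by [iota_act], and the orbit cuts agree after the substitution [d |-> c * d]. *)
Lemma ind_amalg c y : eqv ind_le (a c, y) (1, actC c y).
Proof.
have bl x : R (iota (actG (a c)^-1 x)) y <-> R (iota (actG 1^-1 x)) (actC c y).
  rewrite -(is_homV _ aM) (eqvl Rtot _ (iota_act _ _)) (act_V Rtot actCP) invg1.
  by have [h1 h2] := act_one actGP x; split; apply: (tp_trans Rtot).
have ab x : R y (iota (actG (a c)^-1 x)) <-> R (actC c y) (iota (actG 1^-1 x)).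
  rewrite -(is_homV _ aM) (eqvr Rtot _ (iota_act _ _)) (act_Vr Rtot actCP) invg1.
  by have [h1 h2] := act_one actGP x; split=> h; apply: (tp_trans Rtot h).
have Fe q k : orbit_cut q (a c, y) k <-> orbit_cut q (1, actC c y) k.
  split=> -[d dy kd] /=.
    exists (c * d); last by rewrite aM mul1g.
    by rewrite (eqvl Rtot _ (act_mul actCP _ _ _)); apply: (act_mono actCP).
  exists (c^-1 * d); last by rewrite -aM mulgA mulgV mul1g -[a d]mul1g.
  by rewrite (eqvl Rtot _ (act_mul actCP _ _ _)) (act_V Rtot actCP).
by split; (split=> [|_]; [split=> x /= | right=> q _ k]) => /=;
  rewrite /below /above ?bl ?ab ?Fe.
Qed.

(** Both pairs induce the cut at the point [actG g x] of [X], so [in_base] settles the tie. *)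
Lemma ind_iota g x : eqv ind_le (g, iota x) (1, iota (actG g x)).
Proof.
have bl y : Xle (actG g^-1 y) x <-> Xle (actG 1^-1 y) (actG g x).
  rewrite (act_V Xtot actGP') invg1.
  by have [h1 h2] := act_one actGP y; split; apply: (tp_trans Rtot).
have ab y : Xle x (actG g^-1 y) <-> Xle (actG g x) (actG 1^-1 y).
  rewrite (act_Vr Xtot actGP') invg1.
  by have [h1 h2] := act_one actGP y; split=> h; apply: (tp_trans Rtot h).
have base2 : in_base (1, iota (actG g x)).
  exists (actG g x); rewrite /below /above /= invg1.
  by have [h1 h2] := act_one actGP (actG g x).
have c12 : cut_le (g, iota x) (1, iota (actG g x)) by split=> y; [move/bl | move/ab].
have c21 : cut_le (1, iota (actG g x)) (g, iota x) by split=> y; [move/bl | move/ab].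
by split; split=> // _; left=> //; apply: in_base_eqv base2.
Qed.

End Induction.

(** * Automorphisms of a labelled preorder *)

Record labelled (P : groupType) := Labelled {
  l_car :> Type;
  l_le : l_car -> l_car -> Prop;
  l_lab : l_car -> P;
  l_preorder : total_preorder l_le;
  l_lab_eqv : forall t u, eqv l_le t u -> l_lab t = l_lab u }.

Section Automorphisms.
Variables (P : groupType) (S : labelled P).
Let le := @l_le P S.
Let St : total_preorder le := l_preorder S.

(** The choice is made from the predicate [eqv le t], which is the same for equivalent points; the
    representative therefore depends only on the class. *)
Definition canon (t : S) : S := sval (cid (ex_intro (eqv le t) t (eqv_refl St t))).

Lemma canon_eqv t : eqv le (canon t) t.
Proof. by rewrite /canon; case: cid => u tu; exact: (eqv_sym tu). Qed.

Lemma eq_canon t u : eqv le t u -> canon t = canon u.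
Proof.
move=> tu.
have eqS : eqv le t = eqv le u.
  apply: funext => v; apply: propext.
  by split; apply: (eqv_trans St); [apply: eqv_sym|].
have cid_eq (A B : S -> Prop) (hA : exists v, A v) (hB : exists v, B v) :
    A = B -> sval (cid hA) = sval (cid hB).
  by move=> AB; subst B; rewrite (Prop_irrelevance hA hB).
exact: cid_eq eqS.
Qed.

Lemma canonK t : canon (canon t) = canon t.
Proof. exact/eq_canon/canon_eqv. Qed.

Record realizes (f : S -> S) (p : P) : Prop := Realizes {
  rz_canon : forall t, canon (f t) = f t;
  rz_of_canon : forall t, f (canon t) = f t;
  rz_mono : forall t u, le t u -> le (f t) (f u);
  rz_lab : forall t, l_lab (f t) = p * l_lab t }.

Lemma realizes_comp f g p q : realizes f p -> realizes g q -> realizes (f \o g) (p * q).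
Proof.
move=> [fc cf fm fl] [gc cg gm gl]; split=> [t|t|t u tu|t] /=.
- exact: fc.
- by rewrite cg.
- exact/fm/gm.
- by rewrite fl gl mulgA.
Qed.

Lemma realizes_canon : realizes canon 1.
Proof.
split=> [t|t|t u|t]; rewrite ?canonK //.
  by rewrite -(eqvl St _ (canon_eqv t)) -(eqvr St _ (canon_eqv u)).
by rewrite mul1g (l_lab_eqv (canon_eqv t)).
Qed.

(* Order automorphisms of the quotient of [S] by the equivalence of its
   preorder, encoded as maps between canonical representatives. *)
Record auto := Auto {
  au_fun : S -> S;
  au_inv : S -> S;
  au_lab : P;
  au_funP : realizes au_fun au_lab;
  au_invP : realizes au_inv au_lab^-1;
  au_funK : forall t, au_inv (au_fun t) = canon t;
  au_invK : forall t, au_fun (au_inv t) = canon t }.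

Lemma auto_eq u v : au_fun u =1 au_fun v -> au_inv u =1 au_inv v ->
  au_lab u = au_lab v -> u = v.
Proof.
case: u v => [f f' p fP f'P fK f'K] [g g' q gP g'P gK g'K] /= /funext fg /funext f'g' pq.
move: fP f'P fK f'K gP g'P gK g'K; rewrite {}fg {}f'g' {}pq => *.
by congr Auto; apply: Prop_irrelevance.
Qed.

Lemma au_mul_invP u v :
  realizes (au_inv v \o au_inv u) (au_lab u * au_lab v)^-1.
Proof. by rewrite invgM; apply: realizes_comp; apply: au_invP. Qed.

Lemma au_mul_funK u v t :
  (au_inv v \o au_inv u) ((au_fun u \o au_fun v) t) = canon t.
Proof. by rewrite /= au_funK (rz_of_canon (au_invP v)) au_funK. Qed.

Lemma au_mul_invK u v t :
  (au_fun u \o au_fun v) ((au_inv v \o au_inv u) t) = canon t.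
Proof. by rewrite /= au_invK (rz_of_canon (au_funP u)) au_invK. Qed.

Definition au_mul u v : auto :=
  Auto (realizes_comp (au_funP u) (au_funP v)) (au_mul_invP u v)
    (au_mul_funK u v) (au_mul_invK u v).

Lemma realizes_canonV : realizes canon 1^-1.
Proof. by rewrite invg1; apply: realizes_canon. Qed.

Definition au_one : auto := Auto realizes_canon realizes_canonV canonK canonK.

Lemma au_funPV u : realizes (au_fun u) (au_lab u)^-1^-1.
Proof. by rewrite invgK; apply: au_funP. Qed.

Definition au_opp u : auto := Auto (au_invP u) (au_funPV u) (au_invK u) (au_funK u).

Lemma au_mulA : associative au_mul.
Proof. by move=> u v w; apply: auto_eq => //=; rewrite mulgA. Qed.

Lemma au_mul1 : left_id au_one au_mul.
Proof.
move=> u; apply: auto_eq => [t|t|] /=; last by rewrite mul1g.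
  exact: (rz_canon (au_funP u)).
exact: (rz_of_canon (au_invP u)).
Qed.

Lemma au_mulr1 : right_id au_one au_mul.
Proof.
move=> u; apply: auto_eq => [t|t|] /=; last by rewrite mulg1.
  exact: (rz_of_canon (au_funP u)).
exact: (rz_canon (au_invP u)).
Qed.

Lemma au_mulV : left_inverse au_one au_opp au_mul.
Proof. by move=> u; apply: auto_eq => [t|t|] /=; rewrite ?au_funK ?mulVg. Qed.

Lemma au_mulrV : right_inverse au_one au_opp au_mul.
Proof. by move=> u; apply: auto_eq => [t|t|] /=; rewrite ?au_invK ?mulgV. Qed.

HB.instance Definition _ := gen_eqMixin auto.
HB.instance Definition _ := gen_choiceMixin auto.
HB.instance Definition _ := isGroup.Build auto au_mulA au_mul1 au_mulr1 au_mulV au_mulrV.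

Record lab_action (G : groupType) (i : G -> P) (act : G -> S -> S) : Prop := LabAction {
  la_mono : forall g t u, le t u -> le (act g t) (act g u);
  la_one : forall t, eqv le (act 1 t) t;
  la_mul : forall g h t, eqv le (act (g * h) t) (act g (act h t));
  la_lab : forall g t, l_lab (act g t) = i g * l_lab t }.

Section Realization.
Variables (G : groupType) (i : G -> P) (act : G -> S -> S).
Hypotheses (iM : is_hom i) (actP : lab_action i act).

Lemma la_eqv g t u : eqv le t u -> eqv le (act g t) (act g u).
Proof. by case=> tu ut; split; apply: (la_mono actP). Qed.

Lemma act_realizes g : realizes (canon \o act g) (i g).
Proof.
split=> [t|t|t u tu|t] /=; first exact: canonK.
- exact/eq_canon/la_eqv/canon_eqv.
- exact/(rz_mono realizes_canon)/(la_mono actP).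
- by rewrite (l_lab_eqv (canon_eqv _)) (la_lab actP).
Qed.

Lemma act_realizesV g : realizes (canon \o act g^-1) (i g)^-1.
Proof. by rewrite -(is_homV _ iM); apply: act_realizes. Qed.

Lemma canon_act_mul g h t : canon (act g (canon (act h t))) = canon (act (g * h) t).
Proof.
apply: eq_canon; apply: (eqv_trans St (la_eqv g (canon_eqv _))).
exact: (eqv_sym (la_mul actP g h t)).
Qed.

Lemma act_funK g t : (canon \o act g^-1) ((canon \o act g) t) = canon t.
Proof. by rewrite /= canon_act_mul mulVg; apply/eq_canon; apply: (la_one actP). Qed.

Lemma act_invK g t : (canon \o act g) ((canon \o act g^-1) t) = canon t.
Proof. by rewrite /= canon_act_mul mulgV; apply/eq_canon; apply: (la_one actP). Qed.

Definition auto_of (g : G) : auto :=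
  Auto (act_realizes g) (act_realizesV g) (act_funK g) (act_invK g).

Lemma auto_of_hom : is_hom auto_of.
Proof.
move=> g h; apply: auto_eq => [t|t|] /=; rewrite ?canon_act_mul ?iM //.
by rewrite invgM.
Qed.

End Realization.
End Automorphisms.

(* The universal property maps [P] to the automorphisms of [S]; since the label
   of a translate [x t] is [x] times the label of [t], no element other than
   [1] fixes a point. *)
Lemma amalgam_left_orderable (C G H P : groupType) (a : C -> G) (b : C -> H)
    (iG : G -> P) (iH : H -> P) (S : labelled P) (t0 : S)
    (actG : G -> S -> S) (actH : H -> S -> S) :
  is_amalgamated_product a b iG iH -> is_hom a -> is_hom b ->
  lab_action iG actG -> lab_action iH actH ->
  (forall c t, eqv (@l_le P S) (actG (a c) t) (actH (b c) t)) ->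
  left_orderable P.
Proof.
move=> [iGM iHM iab univ] aM bM aGP aHP aC.
have agree c : auto_of iGM aGP (a c) = auto_of iHM aHP (b c).
  apply: auto_eq => [t|t|] /=; last exact: iab.
    exact: eq_canon.
  by rewrite -!is_homV //; apply: eq_canon.
have [[h [hM hG hH]] _] :=
  univ _ _ _ (auto_of_hom iGM aGP) (auto_of_hom iHM aHP) agree.
have labM : is_hom (fun x => au_lab (h x)) by move=> x y; rewrite hM.
(* The map [au_lab \o h] and the identity of [P] both extend [iG] and [iH], so uniqueness in the
   universal property identifies them. *)
have lab_h x : au_lab (h x) = x.
  have [_ uniq_h] := univ P iG iH iGM iHM iab.
  by apply: uniq_h labM _ _ _ _ _ x => // y; rewrite ?hG ?hH.
pose pt x := au_fun (h x) t0.
have lab_pt x : l_lab (pt x) = x * l_lab t0 by rewrite (rz_lab (au_funP _)) lab_h.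
have St := l_preorder S.
exists (fun x y => l_le (pt x) (pt y)); split.
- by move=> x; apply: (tp_refl St).
- move=> x y xy yx; apply: (mulIg (l_lab t0)); rewrite -!lab_pt.
  exact: (l_lab_eqv (conj xy yx)).
- by move=> x y z; apply: (tp_trans St).
- by move=> x y; apply: St.1.
- move=> g x y xy; rewrite /pt !hM; exact: (rz_mono (au_funP (h g))).
Qed.

(** * Alternating the two factors, and the limit *)

(* [sY] is a [G]-set containing, through [s_iota], the [H]-set [sX] on which the
   two actions of [C] agree; [s_lab] is its equivariant labelling by [P]. *)
Record stage (C G H P : groupType) (a : C -> G) (b : C -> H)
    (iG : G -> P) (iH : H -> P) := Stage {
  sX : Type;
  sY : Type;
  sR : sY -> sY -> Prop;
  s_iota : sX -> sY;
  s_actX : H -> sX -> sX;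
  s_actY : G -> sY -> sY;
  s_lab : sY -> P;
  sR_preorder : total_preorder sR;
  s_actXP : free_action (fun x x' => sR (s_iota x) (s_iota x')) s_actX;
  s_actYP : free_action sR s_actY;
  s_compat : forall c x, eqv sR (s_iota (s_actX (b c) x)) (s_actY (a c) (s_iota x));
  s_lab_eqv : forall y y', eqv sR y y' -> s_lab y = s_lab y';
  s_labX : forall h x, s_lab (s_iota (s_actX h x)) = iH h * s_lab (s_iota x);
  s_labY : forall g y, s_lab (s_actY g y) = iG g * s_lab y }.

Arguments sR {C G H P a b iG iH} s _ _.
Arguments s_iota {C G H P a b iG iH} s _.
Arguments s_actX {C G H P a b iG iH} s _ _.
Arguments s_actY {C G H P a b iG iH} s _ _.
Arguments s_lab {C G H P a b iG iH} s _.

Lemma free_action_comp (C G : groupType) (T : Type) (R : T -> T -> Prop)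
    (a : C -> G) (act : G -> T -> T) :
  is_hom a -> injective a -> free_action R act -> free_action R (fun c => act (a c)).
Proof.
move=> aM aI [mono one mul free]; split=> [c x y|x|c d x|c x].
- exact: mono.
- by rewrite (is_hom1 aM).
- by rewrite aM.
- by move=> /free ac1; apply: aI; rewrite ac1 (is_hom1 aM).
Qed.

Definition wo_lt (T : Type) : T -> T -> Prop := sval (cid (well_order_exists T)).

Lemma wo_lt_wf (T : Type) : well_founded (@wo_lt T).
Proof. by rewrite /wo_lt; case: cid => lt []. Qed.

Lemma wo_lt_tri (T : Type) (i j : T) : [\/ wo_lt i j, i = j | wo_lt j i].
Proof. by rewrite /wo_lt; case: cid => lt []. Qed.

Section Step.
Variables (C G H P : groupType) (a : C -> G) (b : C -> H) (iG : G -> P) (iH : H -> P).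
Hypotheses (aM : is_hom a) (aI : injective a) (bM : is_hom b) (bI : injective b).
Hypotheses (iHM : is_hom iH) (iab : forall c, iG (a c) = iH (b c)).
Hypothesis Ccyc : cyclic_group C.
Variable (le : H -> H -> Prop).
Hypothesis leo : left_order le.
Variable s : stage a b iG iH.

Definition step_le : H * sY s -> H * sY s -> Prop :=
  ind_le le b (sR s) (s_iota s)
    (fun c => s_actY s (a c)) (s_actX s) (@wo_lt _).

Let actCP := free_action_comp aM aI (s_actYP s).

Lemma step_le_preorder : total_preorder step_le.
Proof.
exact: (ind_le_preorder b leo (fun c => s_actY s (a c)) (sR_preorder s) (s_actXP s) (@wo_lt_wf _) (@wo_lt_tri _)).
Qed.

Lemma step_le_unit y y' : step_le (1, y) (1, y') <-> sR s y y'.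
Proof.
exact: (ind_unit leo Ccyc bM bI (sR_preorder s) actCP (s_actXP s) (@wo_lt_wf _)).
Qed.

Lemma step_le_iota h x : eqv step_le (h, s_iota s x) (1, s_iota s (s_actX s h x)).
Proof. exact: (ind_iota _ _ _ (sR_preorder s) (s_actXP s)). Qed.

Lemma step_le_amalg c y : eqv step_le (b c, y) (1, s_actY s (a c) y).
Proof.
exact: (ind_amalg _ bM (sR_preorder s) actCP (s_actXP s) (s_compat (s := s))).
Qed.

Lemma step_eqv z z' : eqv step_le z z' ->
  (exists c, z.1 = z'.1 * b c /\ eqv (sR s) (s_actY s (a c) z.2) z'.2) \/
  (exists x x', [/\ eqv (sR s) z.2 (s_iota s x),
                    eqv (sR s) z'.2 (s_iota s x') &
    eqv (sR s) (s_iota s (s_actX s z.1 x)) (s_iota s (s_actX s z'.1 x'))]).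
Proof.
exact: (ind_eqv leo Ccyc bM bI (sR_preorder s) actCP (s_actXP s) (@wo_lt_wf _)).
Qed.

Definition step_lab (z : H * sY s) : P := iH z.1 * s_lab s z.2.

Lemma step_lab_eqv z z' : eqv step_le z z' -> step_lab z = step_lab z'.
Proof.
rewrite /step_lab => /step_eqv[[c [-> /s_lab_eqv]]|].
  by rewrite s_labY iab iHM => <-; rewrite mulgA.
by move=> [x [x' [/s_lab_eqv-> /s_lab_eqv-> /s_lab_eqv]]]; rewrite !s_labX.
Qed.

(** For freeness, [step_eqv] leaves two cases: some [c] fixes [z.2], so that [c = 1], or [z] comes
    from the old [H]-set and [h] fixes a point there. *)
Lemma step_act : free_action step_le (@translate H (sY s)).
Proof.
split=> [h z z'|z|h k z|h z].
- exact: (ind_le_translate leo (sR_preorder s) (s_actXP s)).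
- by rewrite /translate mul1g; case: z => u y; apply: (eqv_refl step_le_preorder).
- by rewrite /translate /= mulgA; apply: (eqv_refl step_le_preorder).
move=> /step_eqv /= [[c [hc /(act_free actCP) c1]]|].
  move: hc; rewrite c1 (is_hom1 bM) mulg1.
  by rewrite -[RHS]mul1g => /mulIg.
move=> [x [x' [zx zx' xx']]].
have Rt := sR_preorder s.
pose Xle (x x' : sX s) := sR s (s_iota s x) (s_iota s x').
have Xt : total_preorder Xle by split=> [u v|u v w]; [apply: Rt.1 | apply: Rt.2].
have XP : free_action Xle (s_actX s) := s_actXP s.
have x'x : eqv Xle x' x := eqv_trans Rt (eqv_sym zx') zx.
apply: (act_free XP (x := s_actX s z.1 x)).
apply: (eqv_trans Xt (eqv_sym (act_mul XP h z.1 x))).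
exact: (eqv_trans Xt xx' (act_eqv XP z.1 x'x)).
Qed.

Lemma step_base_act : free_action (fun y y' => step_le (1, y) (1, y')) (s_actY s).
Proof.
have unit y y' := step_le_unit y y'; have [mono one mul free] := s_actYP s.
split=> [g x y|x|g h x|g x].
- by rewrite !unit; apply: mono.
- by rewrite /eqv !unit; apply: one.
- by rewrite /eqv !unit; apply: mul.
- by rewrite /eqv !unit; apply: free.
Qed.

Lemma step_compat c y : eqv step_le (1, s_actY s (a c) y) (translate (b c) (1, y)).
Proof. by rewrite /translate /= mulg1; exact: eqv_sym (step_le_amalg c y). Qed.

Lemma step_labX g y : step_lab (1, s_actY s g y) = iG g * step_lab (1, y).
Proof. by rewrite /step_lab /= (is_hom1 iHM) !mul1g s_labY. Qed.

Lemma step_labY h z : step_lab (translate h z) = iH h * step_lab z.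
Proof. by rewrite /step_lab /= iHM mulgA. Qed.

(** The factors exchange roles: the old [sY] with its [G]-action becomes the base, embedded by
    [y |-> (1, y)]. *)
Definition step : stage b a iH iG :=
  Stage step_le_preorder step_base_act step_act step_compat step_lab_eqv
    step_labX step_labY.

End Step.

Section Base.
Variables (C G H P : groupType) (a : C -> G) (b : C -> H) (iG : G -> P) (iH : H -> P).
Variable le : G -> G -> Prop.
Hypotheses (iGM : is_hom iG) (leo : left_order le).

Lemma void_act : free_action (fun x x' : void => le (of_void G x) (of_void G x'))
  (fun (_ : H) x => x).
Proof. by split=> // h; case. Qed.

Lemma left_mul_act : free_action le (fun g x => g * x).
Proof.
have Rt := lo_preorder leo; split=> [g x y|x|g h x|g x].
- by rewrite (lo_mul leo).
- by rewrite mul1g; apply: (eqv_refl Rt).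
- by rewrite mulgA; apply: (eqv_refl Rt).
- by move=> /(lo_anti leo); rewrite -[RHS]mul1g => /mulIg.
Qed.

Lemma void_compat c (x : void) : eqv le (of_void G x) (a c * of_void G x).
Proof. by case: x. Qed.

Lemma void_lab h (x : void) : iG (of_void G x) = iH h * iG (of_void G x).
Proof. by case: x. Qed.

Lemma base_lab_eqv x y : eqv le x y -> iG x = iG y.
Proof. by move=> /(lo_anti leo)->. Qed.

(** The start is [G] under left translation, over the empty [H]-set. *)
Definition stage0 : stage a b iG iH :=
  Stage (lo_preorder leo) void_act left_mul_act void_compat base_lab_eqv void_lab iGM.

End Base.

Section Tower.
Variables (C G H P : groupType) (a : C -> G) (b : C -> H) (iG : G -> P) (iH : H -> P).
Hypotheses (aM : is_hom a) (aI : injective a) (bM : is_hom b) (bI : injective b).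
Hypotheses (iGM : is_hom iG) (iHM : is_hom iH) (iab : forall c, iG (a c) = iH (b c)).
Hypothesis Ccyc : cyclic_group C.
Variables (leG : G -> G -> Prop) (leH : H -> H -> Prop).
Hypotheses (leoG : left_order leG) (leoH : left_order leH).

Let stepH s := step aM aI bM bI iHM iab Ccyc leoH s.
Let stepG s := step bM bI aM aI iGM (fun c => esym (iab c)) Ccyc leoG s.

(** One index covers two extensions, by [H] and then by [G], so that all levels are stages of the
    same type. *)
Fixpoint tower n : stage a b iG iH :=
  if n is m.+1 then stepG (stepH (tower m)) else stage0 a b iH iGM leoG.

Let Y n := sY (tower n).
Let R n := sR (tower n).

Definition emb n (y : Y n) : Y n.+1 := ((1 : G), ((1 : H), y)).
(** In general [Y n] carries no full [H]-action; [H] acts on the intermediate set [H * Y n], whence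
    a map that raises the level by one. *)
Definition tactH n (h : H) (y : Y n) : Y n.+1 := ((1 : G), (h, y)).

Let Rt n : total_preorder (@R n) := sR_preorder (tower n).
Let RP n : free_action (@R n) (s_actY (tower n)) := s_actYP (tower n).

Let unitH n (z z' : sY (stepH (tower n))) :
  R (n := n.+1) (1, z) (1, z') <-> sR (stepH (tower n)) z z'.
Proof. exact: (step_le_unit bM bI aM aI Ccyc leoG). Qed.

Let unitG n (y y' : Y n) : sR (stepH (tower n)) (1, y) (1, y') <-> R y y'.
Proof. exact: (step_le_unit aM aI bM bI Ccyc leoH). Qed.

Lemma emb_le n (y y' : Y n) : R (emb y) (emb y') <-> R y y'.
Proof. by rewrite unitH unitG. Qed.

Lemma tactH_le n h (y y' : Y n) : R y y' -> R (tactH h y) (tactH h y').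
Proof.
rewrite unitH -unitG => /(act_mono (s_actYP (stepH (tower n))) h).
by rewrite /= /translate /= mulg1.
Qed.

Lemma emb_actG n g (y : Y n) :
  eqv (@R n.+1) (s_actY (tower n.+1) g (emb y)) (emb (s_actY (tower n) g y)).
Proof.
have := step_le_iota leG (s := stepH (tower n)) g y.
by rewrite /= /translate /= mulg1.
Qed.

(** The pair [(k, y)] lies in the base [H]-set of level [n.+1], whose action the next extension by
    [H] continues. *)
Lemma tactH_emb n h k (y : Y n) :
  eqv (@R n.+2) (tactH h (tactH k y)) (emb (tactH (h * k) y)).
Proof.
rewrite /eqv !unitH.
have := step_le_iota leH (s := tower n.+1) h ((k, y) : sX (tower n.+1)).
by rewrite /= /translate /=.
Qed.

Lemma tactH_C n c (y : Y n) :
  eqv (@R n.+1) (s_actY (tower n.+1) (a c) (emb y)) (tactH (b c) y).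
Proof.
have := step_le_amalg bM bI aM leG (s := stepH (tower n)) c ((1 : H), y).
by rewrite /= /translate /= !mulg1.
Qed.

Lemma lab_emb n (y : Y n) : s_lab (tower n.+1) (emb y) = s_lab (tower n) y.
Proof. by rewrite /= /step_lab /= /step_lab /= (is_hom1 iGM) (is_hom1 iHM) !mul1g. Qed.

Lemma lab_tactH n h (y : Y n) : s_lab (tower n.+1) (tactH h y) = iH h * s_lab (tower n) y.
Proof. by rewrite /= /step_lab /= /step_lab /= (is_hom1 iGM) mul1g. Qed.

(* The direct limit of the tower, with an element given by a compatible
   sequence of representatives from some index on. *)
Record thread := Thread {
  th : forall n, Y n;
  th_from : nat;
  th_coh : forall n, (th_from <= n)%N -> eqv (@R n.+1) (th n.+1) (emb (th n)) }.

Definition th_le (t u : thread) : Prop :=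
  exists N, forall n, (N <= n)%N -> R (th t n) (th u n).

(** One comparison past both starting indices propagates upwards because [emb] preserves the
    order. *)
Lemma th_le_at (t u : thread) n : (th_from t <= n)%N -> (th_from u <= n)%N ->
  R (th t n) (th u n) -> th_le t u.
Proof.
move=> tn un tu; exists n; elim=> [|m IHm]; first by rewrite leqn0 => /eqP <-.
rewrite leq_eqVlt => /predU1P[<-//|nm].
apply/(eqvl (Rt _) _ (th_coh (leq_trans tn nm))).
apply/(eqvr (Rt _) _ (th_coh (leq_trans un nm))).
by apply/emb_le/IHm.
Qed.

Lemma th_le_preorder : total_preorder th_le.
Proof.
split=> [t u|t u v [N tu] [M uv]].
  have tn := leq_maxl (th_from t) (th_from u); have un := leq_maxr (th_from t) (th_from u).
  by have [tu|ut] := (@Rt _).1 (th t (maxn (th_from t) (th_from u))) (th u _);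
    [left|right]; apply: th_le_at _ _ _; eassumption.
exists (maxn N M) => n; rewrite geq_max => /andP[Nn Mn].
exact: (tp_trans (@Rt n) (tu n Nn) (uv n Mn)).
Qed.

Lemma th_eqv (t u : thread) N :
  (forall n, (N <= n)%N -> eqv (@R n) (th t n) (th u n)) -> eqv th_le t u.
Proof. by move=> tu; split; exists N => n /tu[]. Qed.

Definition th_lab (t : thread) : P := s_lab (tower (th_from t)) (th t (th_from t)).

Lemma th_lab_at (t : thread) n : (th_from t <= n)%N -> s_lab (tower n) (th t n) = th_lab t.
Proof.
elim: n => [|n IHn]; first by rewrite leqn0 /th_lab => /eqP->.
rewrite leq_eqVlt => /predU1P[<-//|tn]; rewrite -IHn //.
by rewrite (s_lab_eqv (th_coh tn)) lab_emb.
Qed.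

Lemma th_lab_eqv t u : eqv th_le t u -> th_lab t = th_lab u.
Proof.
move=> [[N tu] [M ut]]; pose n := maxn (maxn N M) (maxn (th_from t) (th_from u)).
have : [&& N <= n, M <= n, th_from t <= n & th_from u <= n]%N.
  by rewrite !leq_max !leqnn !orbT.
move=> /and4P[Nn Mn tn un]; rewrite -(th_lab_at tn) -(th_lab_at un).
by apply: s_lab_eqv; split; [apply: tu | apply: ut].
Qed.

Lemma th_actG_coh g (t : thread) n : (th_from t <= n)%N ->
  eqv (@R n.+1) (s_actY (tower n.+1) g (th t n.+1)) (emb (s_actY (tower n) g (th t n))).
Proof.
move=> /th_coh/(act_eqv (@RP n.+1) g) h.
exact: (eqv_trans (@Rt _) h (emb_actG _ _)).
Qed.

Definition th_actG g (t : thread) : thread := Thread (@th_actG_coh g t).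

(** The shift accounts for the level raised by [tactH]. The value at [0] is a filler: coherence is
    required only from [(th_from t).+1] on. *)
Definition th_seqH h (t : thread) n : Y n :=
  if n is m.+1 then tactH h (th t m) else th t 0.

Lemma th_actH_coh h (t : thread) n : (th_from t < n)%N ->
  eqv (@R n.+1) (th_seqH h t n.+1) (emb (th_seqH h t n)).
Proof.
case: n => // n tn; have [le1 le2] := th_coh (tn : (th_from t <= n)%N).
apply: (eqv_trans (@Rt _) (conj (tactH_le h le1) (tactH_le h le2))).
(* By definition [emb] is [tactH 1]. *)
by have := tactH_emb h 1 (th t n); rewrite mulg1.
Qed.

Definition th_actH h (t : thread) : thread := Thread (@th_actH_coh h t).

Lemma th_actG_mono g t u : th_le t u -> th_le (th_actG g t) (th_actG g u).
Proof. by move=> [N tu]; exists N => n /tu; apply: (act_mono (@RP n)). Qed.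

Lemma th_actG_one t : eqv th_le (th_actG 1 t) t.
Proof. by apply: (@th_eqv _ _ 0) => n _; apply: (act_one (@RP n)). Qed.

Lemma th_actG_mul g h t : eqv th_le (th_actG (g * h) t) (th_actG g (th_actG h t)).
Proof. by apply: (@th_eqv _ _ 0) => n _; apply: (act_mul (@RP n)). Qed.

Lemma th_lab_actG g t : th_lab (th_actG g t) = iG g * th_lab t.
Proof. exact: s_labY. Qed.

Lemma th_actH_mono h t u : th_le t u -> th_le (th_actH h t) (th_actH h u).
Proof. by move=> [N tu]; exists N.+1; case=> // n /tu; apply: tactH_le. Qed.

Lemma th_actH_one t : eqv th_le (th_actH 1 t) t.
Proof.
apply: (@th_eqv _ _ (th_from t).+1); case=> // n tn.
exact: eqv_sym (th_coh (tn : (th_from t <= n)%N)).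
Qed.

Lemma th_actH_mul g h t : eqv th_le (th_actH (g * h) t) (th_actH g (th_actH h t)).
Proof.
apply: (@th_eqv _ _ (th_from t).+2); case=> [|[|n]] // tn.
apply: eqv_sym; apply: (eqv_trans (@Rt _) (tactH_emb _ _ _)).
apply: eqv_sym; apply: (@th_actH_coh (g * h) t n.+1); exact: tn.
Qed.

Lemma th_lab_actH h t : th_lab (th_actH h t) = iH h * th_lab t.
Proof. exact: lab_tactH. Qed.

Lemma th_act_C c t : eqv th_le (th_actG (a c) t) (th_actH (b c) t).
Proof.
apply: (@th_eqv _ _ (th_from t).+1); case=> // n tn.
have h := act_eqv (@RP n.+1) (a c) (th_coh (tn : (th_from t <= n)%N)).
exact: (eqv_trans (@Rt _) h (tactH_C _ _)).
Qed.

Lemma thread_exists : exists t : thread, True.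
Proof.
pose f := fix f n : Y n := if n is m.+1 then emb (f m) else (1 : G).
by exists (@Thread f 0 (fun n _ => eqv_refl (@Rt _) _)).
Qed.

Lemma amalgam_of_left_orders :
  is_amalgamated_product a b iG iH -> left_orderable P.
Proof.
move=> amalg; have [t0 _] := thread_exists.
pose S := Labelled th_le_preorder th_lab_eqv.
have actG : lab_action (S := S) iG th_actG.
  by split; [exact: th_actG_mono | exact: th_actG_one | exact: th_actG_mul | exact: th_lab_actG].
have actH : lab_action (S := S) iH th_actH.
  by split; [exact: th_actH_mono | exact: th_actH_one | exact: th_actH_mul | exact: th_lab_actH].
exact: (amalgam_left_orderable (S := S) t0 amalg aM bM actG actH th_act_C).
Qed.

End Tower.

(** * Torsion-free nilpotent groups *)

Record normal_subgroup (H : groupType) (N : H -> Prop) : Prop := NormalSubgroup {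
  ns_one : N 1;
  ns_mul : forall x y, N x -> N y -> N (x * y);
  ns_inv : forall x, N x -> N x^-1;
  ns_conj : forall x g, N x -> N (x ^ g) }.

Definition isolated (H : groupType) (N : H -> Prop) : Prop :=
  forall (x : H) n, (0 < n)%N -> N (x ^+ n) -> N x.

Section Congruence.
Variables (H : groupType) (N : H -> Prop).
Hypothesis NN : normal_subgroup N.

Definition cong (x y : H) : Prop := N (x^-1 * y).

Lemma cong_refl x : cong x x.
Proof. by rewrite /cong mulVg; apply: ns_one. Qed.

Lemma cong_sym x y : cong x y -> cong y x.
Proof. by move=> /(ns_inv NN); rewrite invgM invgK. Qed.

Lemma cong_trans x y z : cong x y -> cong y z -> cong x z.
Proof. by move=> xy /(ns_mul NN xy); rewrite mulgA mulgK. Qed.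

Lemma cong_mul x y x' y' : cong x x' -> cong y y' -> cong (x * y) (x' * y').
Proof.
move=> xx' /(ns_mul NN (ns_conj NN y xx')).
by rewrite /cong conjgE !gnorm.
Qed.

Lemma cong_exp x y n : cong x y -> cong (x ^+ n) (y ^+ n).
Proof.
move=> xy; elim: n => [|n IHn]; first exact: cong_refl.
by rewrite !expgS; apply: cong_mul.
Qed.

Lemma cong1 x : cong 1 x <-> N x.
Proof. by rewrite /cong invg1 mul1g. Qed.

Lemma cong_commg x g : N [~ x, g] <-> cong (g * x) (x * g).
Proof. by rewrite /cong commgEl conjgE invgM !mulgA. Qed.

Lemma cong_commX x u n : cong (u * x) (x * u) -> cong (u * x ^+ n) (x ^+ n * u).
Proof.
move=> ux; elim: n => [|n IHn]; first by rewrite expg0 mulg1 mul1g; apply: cong_refl.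
rewrite expgS mulgA; apply: cong_trans (cong_mul ux (cong_refl _)) _.
by rewrite -!mulgA; apply: cong_mul IHn; apply: cong_refl.
Qed.

Lemma cong_expM x u n : cong (u * x) (x * u) -> cong ((x * u) ^+ n) (x ^+ n * u ^+ n).
Proof.
move=> ux; elim: n => [|n IHn]; first by rewrite !expg0 mulg1; apply: cong_refl.
rewrite !expgS; apply: cong_trans (cong_mul (cong_refl _) IHn) _.
rewrite -!mulgA; apply: cong_mul; first exact: cong_refl.
rewrite !mulgA; apply: cong_mul; last exact: cong_refl.
exact: cong_commX.
Qed.

End Congruence.

(** * The upper central series and positive cones on its sections *)

Section UpperCentralSeries.
Variable H : groupType.

Fixpoint ucs (n : nat) (x : H) : Prop :=
  if n is m.+1 then forall g, ucs m [~ x, g] else x = 1.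

Lemma ucs_normal n : normal_subgroup (ucs n).
Proof.
elim: n => [|n [IH1 IHM IHV IHJ]].
  by split=> /= [|x y -> ->|x ->|x g ->]; rewrite ?mulg1 ?invg1 ?conj1g.
split=> /= [g|x y Zx Zy g|x Zx g|x h Zx g].
- by rewrite comm1g.
- have -> : [~ x * y, g] = [~ x, g] ^ y * [~ y, g] by rewrite !commgEl !conjgE !gnorm.
  by apply: IHM (Zy g); apply: IHJ; apply: Zx.
- have -> : [~ x^-1, g] = ([~ x, g]^-1) ^ x^-1 by rewrite !commgEl !conjgE !gnorm.
  by apply: IHJ; apply: IHV; apply: Zx.
- rewrite -[g](conjgKV h) -conjRg; by apply: IHJ; apply: Zx.
Qed.

Lemma ucs_succ n x : ucs n x -> ucs n.+1 x.
Proof.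
move=> Zx g; have NN := ucs_normal n; rewrite commgEl.
by apply: (ns_mul NN); [apply: (ns_inv NN) | apply: (ns_conj NN _)].
Qed.

(** By induction on [i], the term [lcs (c - i)] lies in [ucs i]; at [i = c] the former is the whole
    group. *)
Lemma nilpotent_ucs : nilpotent H -> exists c, forall g, ucs c g.
Proof.
move=> [c lcs1]; exists c.
suff lcs_ucs i : (i <= c)%N -> forall x, lcs (c - i) x -> ucs i x.
  by move=> g; apply: (lcs_ucs c) => //; rewrite subnn.
elim: i => [|i IHi] ic x; first by rewrite subn0 => /lcs1.
move=> lx g; apply: (IHi (ltnW ic)).
rewrite -[(c - i)%N]prednK ?subn_gt0 // -subnS /= => K _; apply.
by exists x, g; split=> //; rewrite -mulgA.
Qed.

(* In a torsion-free nilpotent group the terms of the upper central series are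
   isolated: by induction along the series, modulo [ucs i] the element [x]
   commutes with [u = [~ x, g]], so [(x ^ g) ^+ n = (x * u) ^+ n] gives
   [u ^+ n] in [ucs i]. *)
Lemma ucs_isolated c i : torsion_free H -> (forall g, ucs c g) -> isolated (ucs i).
Proof.
move=> tf Zc; elim: i => [|i iso] x n n_gt0 Zxn; first exact: tf n_gt0 Zxn.
have NN := ucs_normal i.
(* The inner induction is on the term containing [g]: if [g] is in [ucs j.+1] then [u] is in
   [ucs j], so by induction [x] and [u] commute modulo [ucs i]. *)
suff comm j g : ucs j g -> ucs i [~ x, g] by move=> g; apply: (comm c).
elim: j g => [|j IHj] g /=; first by move=> ->; rewrite commg1; apply: (ns_one NN).
move=> Zg; set u := [~ x, g]; apply: (iso u n n_gt0).
have ux : cong (ucs i) (u * x) (x * u).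
  by apply/cong_commg/IHj; rewrite /u -invgR; apply: (ns_inv (ucs_normal j)).
have := cong_expM NN n ux; have -> : x * u = x ^ g by rewrite /u commgEl mulVKg.
rewrite -conjXg => /(cong_trans NN (Zxn g)).
by rewrite /cong mulKg.
Qed.

(** A union of cosets of [N], that is, a subsemigroup of the section of [M] by [N] avoiding the
    identity. *)
Record positive_cone (M N S : H -> Prop) : Prop := PositiveCone {
  pc_sub : forall x, S x -> M x /\ ~ N x;
  pc_mul : forall x y, S x -> S y -> S (x * y);
  pc_coset : forall x n, S x -> N n -> S (x * n) }.

(** A maximal cone [A] is total. If it missed [x] and [x^-1], maximality would give [s], [t] in [A]
    and [k], [l > 0] with [s * x ^+ k] and [t * x ^- l] in [N]; then [s ^+ l * t ^+ k] would be in
    both [A] and [N]. *)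
Lemma central_cone (M N : H -> Prop) : normal_subgroup M -> normal_subgroup N ->
  (forall x, N x -> M x) -> (forall x g, M x -> N [~ x, g]) -> isolated N ->
  exists2 S, positive_cone M N S & forall x, M x -> [\/ N x, S x | S x^-1].
Proof.
move=> NM NN sNM comm iso.
have [|A [Apos Amax]] := @Zorn_bigcup H (positive_cone M N).
  move=> F FP Ftot; split=> [x [S FS Sx]|x y [S FS Sx] [T FT Ty]|x n [S FS Sx] Nn].
  - exact: (pc_sub (FP S FS)).
  - have [ST|TS] := Ftot S T FS FT.
      by exists T => //; apply: (pc_mul (FP T FT)) => //; apply: ST.
    by exists S => //; apply: (pc_mul (FP S FS)) => //; apply: TS.
  - by exists S => //; apply: (pc_coset (FP S FS)).
exists A => // x Mx; apply: contrapT => nor.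
have nNx : ~ N x by move=> Nx; apply: nor; constructor 1.
have nAx : ~ A x by move=> Ax; apply: nor; constructor 2.
have nAVx : ~ A x^-1 by move=> Ax; apply: nor; constructor 3.
have NA n s : N n -> A s -> A (n * s).
  by move=> Nn As; rewrite conjgC; apply: (pc_coset Apos As); apply: (ns_conj NN).
have extend y : M y -> ~ N y -> ~ A y ->
    exists s k, [/\ A s, (0 < k)%N & N (s * y ^+ k)].
  move=> My nNy nAy.
  have MX k : M (y ^+ k).
    elim: k => [|k IHk]; first exact: (ns_one NM).
    by rewrite expgS; apply: (ns_mul NM).
  pose T s := A s \/ N s.
  have TM s t : T s -> T t -> T (s * t).
    move=> [As|Ns] [At|Nt]; [left|left|left|right].
    - exact: (pc_mul Apos). - exact: (pc_coset Apos).
    - exact: NA. - exact: (ns_mul NN).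
  (* The cone generated by [A] and [y]; the side condition excludes [s] in [N] with [k = 0], which
     would give elements of [N]. *)
  pose B z := exists s k, [/\ T s, (0 < k)%N \/ A s & z = s * y ^+ k].
  have [[s [k [Ts ks Nsk]]]|BN] := EM (exists s k, [/\ T s, (0 < k)%N \/ A s & N (s * y ^+ k)]).
    case: Ts => [As|Ns].
      exists s, k; split=> //; rewrite lt0n; apply/eqP => k0.
      by case: (pc_sub Apos As).2; move: Nsk; rewrite k0 expg0 mulg1.
    (* With [s] in [N], already [y ^+ k] is in [N], and isolation puts [y] there. *)
    case: ks => [k_gt0|/(pc_sub Apos)[]//]; case: nNy; apply: (iso y k k_gt0).
    by have := ns_mul NN (ns_inv NN Ns) Nsk; rewrite mulKg.
  case: (Amax B); first split.
  - by move=> s As; exists s, 0%N; split; [left|right|rewrite expg0 mulg1].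
  - move=> sBA; apply/nAy/sBA; exists 1, 1%N; split; last by rewrite mul1g.
      by right; apply: (ns_one NN).
    by left.
  split=> [z|z w|z n].
  - move=> [s [k [Ts ks ->]]]; split; last by move=> Nsk; apply: BN; exists s, k.
    by apply: (ns_mul NM) (MX k); case: Ts => [/(pc_sub Apos)[]//|/sNM].
  - move=> [s [k [Ts ks ->]]] [t [l [Tt lt ->]]].
    (* This is the cost of moving [t] to the left past [y ^+ k]; centrality of the section keeps it
       in [N]. *)
    have Nn : N ([~ y ^+ k, t] ^ y ^- k) by apply: (ns_conj NN); apply: comm.
    exists (s * t * [~ y ^+ k, t] ^ y ^- k), (k + l)%N; split.
    + by apply: (TM _ _ (TM _ _ Ts Tt)); right.
    + case: ks lt => [k0|As] [l0|At]; first by left; rewrite addn_gt0 k0.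
      * right; apply: (pc_coset Apos) Nn; case: Ts => [As|Ns]; last exact: NA.
        exact: (pc_mul Apos).
      * right; apply: (pc_coset Apos) Nn; case: Tt => [At|Nt].
          exact: (pc_mul Apos).
        exact: (pc_coset Apos).
      * by right; apply: (pc_coset Apos) Nn; apply: (pc_mul Apos).
    + by rewrite expgnDr !commgEl !conjgE !gnorm.
  - move=> [s [k [Ts ks ->]]] Nn.
    have Nn' : N (n ^ y ^- k) by apply: (ns_conj NN).
    exists (s * n ^ y ^- k), k; split.
    + by apply: TM => //; right.
    + by case: ks => [|As]; [left | right; apply: (pc_coset Apos)].
    + by rewrite conjgE !gnorm.
have [s [k [As k0 Ns]]] := extend x Mx nNx nAx.
have nNV : ~ N x^-1 by move=> /(ns_inv NN); rewrite invgK.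
have [t [l [At l0 Nt]]] := extend _ (ns_inv NM Mx) nNV nAVx.
have AX u m : (0 < m)%N -> A u -> A (u ^+ m).
  case: m => // m _ Au; elim: m => [|m IHm]; first by rewrite expg1.
  by rewrite expgS; apply: (pc_mul Apos).
case: (pc_sub Apos (pc_mul Apos (AX s l l0 As) (AX t k k0 At))).2.
have sx : cong N s (x ^- k).
  apply: (cong_sym NN); rewrite /cong invgK.
  by have := ns_conj NN (x ^- k) Ns; rewrite conjgE !gnorm.
have tx : cong N t (x ^+ l).
  apply: (cong_sym NN); rewrite /cong -expVgn.
  by have := ns_conj NN (x^-1 ^- l) Nt; rewrite conjgE !gnorm.
apply/cong1/(cong_sym NN).
have := cong_mul NN (cong_exp NN l sx) (cong_exp NN k tx).
by rewrite -expVgn -!expgnA mulnC expVgn mulVg.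
Qed.

(** The cones of the sections are combined lexicographically: the top section decides, and elements
    trivial there are left to the induction. *)
Lemma ucs_cone i : (forall j, (j < i)%N -> isolated (ucs j)) ->
  exists2 S : H -> Prop,
    [/\ forall x, S x -> ucs i x, forall x y, S x -> S y -> S (x * y) & ~ S 1] &
    forall x, ucs i x -> [\/ x = 1, S x | S x^-1].
Proof.
elim: i => [|i IHi] iso.
  by exists (fun _ => False); [split | move=> x; constructor 1].
have [j ji|S [Ssub SM S1] Stot] := IHi; first by apply: iso; apply: ltnW.
have NN := ucs_normal i.
have [A Apos Atot] := central_cone (ucs_normal i.+1) NN (@ucs_succ i)
  (fun x g Zx => Zx g) (iso i (leqnn _)).
exists (fun x => S x \/ A x).
  split.
  - by move=> x [/Ssub/ucs_succ|/(pc_sub Apos)[]].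
  - move=> x y [Sx|Ax] [Sy|Ay]; [left|right|right|right].
    + exact: SM.
    + by rewrite conjgC; apply: (pc_coset Apos Ay); apply: (ns_conj NN); apply: Ssub.
    + by apply: (pc_coset Apos Ax); apply: Ssub.
    + exact: (pc_mul Apos).
  - by move=> [//|/(pc_sub Apos)[_]]; apply; apply: (ns_one NN).
move=> x /Atot[/Stot[]||] h; [constructor 1|constructor 2|constructor 3|constructor 2|constructor 3] => //.
- by left. - by left. - by right. - by right.
Qed.

End UpperCentralSeries.

Lemma nilpotent_left_orderable (H : groupType) :
  torsion_free H -> nilpotent H -> left_orderable H.
Proof.
move=> tf /nilpotent_ucs[c Zc].
have [j _|S [_ SM S1] Stot] := @ucs_cone H c; first exact: ucs_isolated tf Zc.
exists (fun x y => x = y \/ S (x^-1 * y)); split.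
- by move=> x; left.
- move=> x y [//|Sxy] [//|Syx]; case: S1.
  by have := SM _ _ Sxy Syx; rewrite mulgA mulgK mulVg.
- move=> x y z [->//|Sxy] [<-|Syz]; right=> //.
  by have := SM _ _ Sxy Syz; rewrite mulgA mulgK.
- move=> x y; have [xy|Sxy|Sxy] := Stot _ (Zc (x^-1 * y)).
  + by left; left; rewrite -[y](mulVKg x) xy mulg1.
  + by left; right.
  + by right; right; move: Sxy; rewrite invgM invgK.
- move=> g x y [->|Sxy]; [by left | right].
  by rewrite invgM -mulgA mulKg.
Qed.

Theorem theorem6p3 (G H C P : groupType) (le : G -> G -> Prop)
  (a : C -> G) (b : C -> H) (iG : G -> P) (iH : H -> P) :
  left_order le ->
  torsion_free H -> nilpotent H ->
  cyclic_group C ->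
  is_hom a -> injective a -> is_hom b -> injective b ->
  is_amalgamated_product a b iG iH ->
  left_orderable P.
Proof.
move=> leoG tf nilp Ccyc aM aI bM bI amalg.
have [leH leoH] := nilpotent_left_orderable tf nilp.
have [iGM iHM iab _] := amalg.
exact: (amalgam_of_left_orders aM aI bM bI iGM iHM iab Ccyc leoG leoH amalg).
Qed.
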